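(* Let $G$ be a finite group, let $\rho:G\to U(V)$ be a unitary representation on a finite-dimensional complex inner product space $V$, let $\chi$ be an irreducible complex character of $G$ of degree $d=\chi(1)$, and let $V_\chi\subseteq V$ be the $\chi$-isotypic component of $V$. If $v\in V_\chi$ and $\|v\|=1$, then $$F(v)=\frac1{|G|}\sum_{g\in G}|\langle v,\rho(g)v\rangle|^2\le \frac1d.$$ Equality $F(v)=\frac1d$ holds if and only if the cyclic subspace $\operatorname{span}\{\rho(g)v: g\in G\}$ is an irreducible subrepresentation of $V$ affording $\chi$ (i.e. with character $\chi$).
   Context: All representations are complex. Hermitian inner products are conjugate-linear in the first variable and linear in the second. The $\chi$-isotypic projector on $V$ is $P_\chi=\frac{d}{|G|}\sum_{g\in G}\overline{\chi(g)}\,\rho(g)$, and the $\chi$-isotypic component is its image $V_\chi=P_\chi V$. For $v\in V$, $F(v)=\frac1{|G|}\sum_{g\in G}|\langle v,\rho(g)v\rangle|^2$. *)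

(* Defs.v *)
From HB Require Import structures.
From mathcomp Require Import all_boot all_order all_fingroup all_algebra.
From mathcomp Require Import mxrepresentation sesquilinear.
From mathcomp Require Import reals complex.

Set Implicit Arguments.
Unset Strict Implicit.
Unset Printing Implicit Defensive.

Import Order.TTheory GRing.Theory Num.Theory.
Local Open Scope ring_scope.

Section UnitaryRepresentations.

Variables (C : numClosedFieldType) (gT : finGroupType) (G : {group gT}).
Variables (V : vectType C) (form : {dot V for Num.conj}).

(* MathComp's [form] is linear in its first argument and conjugate-linear in
   its second; the swap makes [inner] conjugate-linear in the first argument
   and linear in the second. *)
Definition inner (u w : V) : C := form w u.

Definition vnorm (v : V) : C := sqrtC (inner v v).

(* Only the values of [rho] on [G] matter, as for [mx_representation]. *)
Definition is_unitary_repr (rho : gT -> 'End(V)) : Prop :=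
  [/\ rho 1%g = \1%VF,
      {in G &, forall g h, rho (g * h)%g = (rho g \o rho h)%VF}
    & {in G, forall g u w, inner (rho g u) (rho g w) = inner u w}].

Definition irreducible_character (chi : gT -> C) : Prop :=
  exists (n : nat) (rG : mx_representation C G n),
    mx_irreducible rG /\ {in G, forall g, chi g = \tr (rG g)}.

Variable rho : gT -> 'End(V).

Definition isotypic_proj (chi : gT -> C) : 'End(V) :=
  (chi 1%g / #|G|%:R) *: \sum_(g in G) (chi g)^* *: rho g.

Definition isotypic_component (chi : gT -> C) : {vspace V} :=
  limg (isotypic_proj chi).

Definition mean_sq_coef (v : V) : C :=
  #|G|%:R^-1 * \sum_(g in G) `|inner v (rho g v)| ^+ 2.

Definition cyclic_subspace (v : V) : {vspace V} :=
  <<[seq rho g v | g in G]>>%VS.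

Definition invariant_subspace (W : {vspace V}) : Prop :=
  {in G, forall g, (rho g @: W <= W)%VS}.

Definition irreducible_subrepr (W : {vspace V}) : Prop :=
  [/\ invariant_subspace W, W != 0%VS
    & forall U : {vspace V}, invariant_subspace U -> (U <= W)%VS ->
        U = 0%VS \/ U = W].

(* The trace, computed in the basis [vbasis W], of the endomorphism of [W]
   that [rho g] induces when [W] is invariant under [rho g]. *)
Definition subrepr_character (W : {vspace V}) (g : gT) : C :=
  \sum_(i < \dim W) coord (vbasis W) i (rho g (vbasis W)`_i).

End UnitaryRepresentations.

(* Main.v *)
Require Import Defs.
From HB Require Import structures.
From mathcomp Require Import all_boot all_order all_fingroup all_algebra.
From mathcomp Require Import mxrepresentation sesquilinear.
From mathcomp Require Import reals complex.

Set Implicit Arguments.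
Unset Strict Implicit.
Unset Printing Implicit Defensive.

Import Order.TTheory GRing.Theory Num.Theory.
Local Open Scope ring_scope.

(** The frame operator S x = (1/|G|) sum_g <rho(g) v, x> rho(g) v of the orbit
    of v is self-adjoint, commutes with rho and satisfies F(v) = <v, S v>.

    Let E be an eigenspace of S inside the cyclic subspace of v, and write
    v = e + e' with e in E and e' orthogonal to E.  Both E and its orthogonal
    complement are invariant.  Since the orbit of e' is orthogonal to E, S acts
    on E as the frame operator of e, whose trace is <e, e>; hence the eigenvalue
    is <e, e> / dim E.  As S maps E to E and, being self-adjoint, the complement
    to the complement, <v, S v> splits into
      F(v) = <e, e>^2 / dim E + F(e')     (lemma [eigenspace_splitting]).
    The cyclic subspace of e' is strictly smaller, so if n bounds below the
    dimensions of the nonzero invariant subspaces at hand, induction gives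
      F(v) <= (<e, e>^2 + <e', e'>^2) / n <= <v, v>^2 / n,
    where equality kills the cross term <e, e> <e', e'>, hence e', and forces
    the cyclic subspace to be E, of dimension n (lemma [mean_sq_coef_bound]).
    If the cyclic subspace is irreducible, then E is all of it, and
    F(v) = <v, v>^2 / dim (lemma [mean_sq_coef_irreducible]).

    It remains to see that a nonzero invariant subspace U of the chi-isotypic
    component has dimension at least d = chi(1), and character chi when its
    dimension is d.  The projector P_chi does not kill U, so some operator
    sum_g conj(r(g)_ij) rho(g), with r a matrix representation affording chi,
    is nonzero on U.  For a fixed column index j these operators carry the
    representation r into U, injectively as r is irreducible
    (lemma [isotypic_copy]): U contains a copy of r. *)

(** * Endomorphisms stabilizing a subspace *)

(** Lets a character, defined through an arbitrary basis, be computed in a basis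
    adapted to a matrix representation. *)
Lemma trace_basis_indep (K : fieldType) (V : vectType K) (f : 'End(V))
    (W : {vspace V}) n m (X : n.-tuple V) (Y : m.-tuple V) :
    basis_of W X -> basis_of W Y -> (f @: W <= W)%VS ->
  \sum_(i < n) coord X i (f X`_i) = \sum_(k < m) coord Y k (f Y`_k).
Proof.
move=> bX bY fW.
have memX (i : 'I_n) : X`_i \in W.
  by rewrite (basis_mem bX) ?mem_nth ?size_tuple.
have memfY (k : 'I_m) : f Y`_k \in W.
  by rewrite (subvP fW) ?memv_img // (basis_mem bY) ?mem_nth ?size_tuple.
transitivity (\sum_(i < n) \sum_(k < m)
                coord Y k X`_i * coord X i (f Y`_k)).
  apply: eq_bigr => i _; rewrite {1}(coord_basis bY (memX i)) !linear_sum.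
  by apply: eq_bigr => k _; rewrite !linearZ.
rewrite exchange_big; apply: eq_bigr => k _ /=.
rewrite [in RHS](coord_basis bX (memfY k)) linear_sum.
by apply: eq_bigr => i _; rewrite linearZ /= mulrC.
Qed.

Lemma eigenvector_stable (F : closedFieldType) (V : vectType F)
    (f : 'End(V)) (W : {vspace V}) :
    W != 0%VS -> (f @: W <= W)%VS ->
  exists a x, [/\ x \in W, x != 0 & f x = a *: x].
Proof.
move=> W_neq0 fW.
(* Row i holds the coordinates of f b_i: row vectors multiply A on its left. *)
pose A := \matrix_(i < \dim W, j < \dim W) coord (vbasis W) j (f (vbasis W)`_i).
have /closed_rootP[a] : size (char_poly A) != 1.
  by rewrite size_char_poly eqSS dimv_eq0.
rewrite -eigenvalue_root_char => /eigenvalueP[y yA y_neq0].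
pose x := \sum_(i < \dim W) y 0 i *: (vbasis W)`_i; exists a, x.
have memb (i : 'I_(\dim W)) : (vbasis W)`_i \in W.
  by rewrite vbasis_mem ?mem_nth ?size_tuple.
have coord_x i : coord (vbasis W) i x = y 0 i.
  by rewrite coord_sum_free ?(basis_free (vbasisP W)).
split; first by apply: memv_suml => i _; rewrite memvZ.
- apply: contraNneq y_neq0 => x0; apply/eqP/rowP => i.
  by rewrite -coord_x x0 linear0 mxE.
rewrite /x linear_sum scaler_sumr /=.
under eq_bigr => i _.
  rewrite linearZ /= (coord_vbasis (subvP fW _ (memv_img f (memb i)))).
  rewrite scaler_sumr; over.
rewrite exchange_big; apply: eq_bigr => j _ /=.
have := congr1 (fun z : 'rV_(\dim W) => z 0 j) yA; rewrite !mxE => yAj.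
rewrite scalerA -yAj scaler_suml; apply: eq_bigr => i _.
by rewrite mxE scalerA.
Qed.

(** * The inner product *)

Section Inner.
Variables (C : numClosedFieldType) (V : vectType C).
Variable form : {dot V for Num.conj}.
Implicit Types (u w x : V).
Local Notation "'[ u , w ]" := (inner form u w).

Lemma innerC u w : '[u, w] = '[w, u]^*.
Proof. by rewrite /inner hermC expr0 mul1r. Qed.

Lemma innerDr u w x : '[u, w + x] = '[u, w] + '[u, x].
Proof. exact: linearDl. Qed.

Lemma innerZr u a w : '[u, a *: w] = a * '[u, w].
Proof. exact: linearZl_LR. Qed.

Lemma inner_sumr u I (r : seq I) (P : pred I) (F : I -> V) :
  '[u, \sum_(i <- r | P i) F i] = \sum_(i <- r | P i) '[u, F i].
Proof. exact: linear_sumlz. Qed.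

Lemma inner0r u : '[u, 0] = 0. Proof. exact: linear0l. Qed.

Lemma innerDl u w x : '[u + w, x] = '[u, x] + '[w, x].
Proof. exact: linearDr. Qed.

Lemma innerZl u a w : '[a *: u, w] = a^* * '[u, w].
Proof. exact: linearZr_LR. Qed.

Lemma inner_suml I (r : seq I) (P : pred I) (F : I -> V) w :
  '[\sum_(i <- r | P i) F i, w] = \sum_(i <- r | P i) '[F i, w].
Proof. exact: linear_sumr. Qed.

Lemma inner_ge0 u : 0 <= '[u, u]. Proof. exact: dnorm_ge0. Qed.

Lemma inner_eq0 u : ('[u, u] == 0) = (u == 0). Proof. exact: dnorm_eq0. Qed.

Lemma mem_orthov_inner (W : {vspace V}) u :
  reflect {in W, forall w, '[w, u] = 0} (u \in orthov form W).
Proof. exact: mem_orthovP. Qed.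

Lemma orthov_capv (W : {vspace V}) : (W :&: orthov form W)%VS = 0%VS.
Proof.
apply/eqP; rewrite -subv0; apply/subvP => x; rewrite memv_cap memv0.
by case/andP => xW /mem_orthov_inner/(_ x xW)/eqP; rewrite inner_eq0.
Qed.

Lemma orthogonal_decomposition (W : {vspace V}) u :
  exists e e', [/\ u = e + e', e \in W & e' \in orthov form W].
Proof.
have [e eW [e' [-> _ /orthoPl oe']]] := orthogonal_split form (vbasis W) u.
exists e, e'; rewrite (span_basis (vbasisP W)) in eW; split => //.
apply/mem_orthov_inner => w /coord_vbasis ->.
rewrite inner_suml big1 // => i _.
by rewrite innerZl [inner _ _ _]oe' ?mulr0 // mem_nth ?size_tuple.
Qed.

End Inner.

(** * Invariant subspaces and the frame operator of an orbit *)

Lemma sum_group_mull (gT : finGroupType) (G : {group gT})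
    (M : nmodType) (F : gT -> M) h :
  h \in G -> \sum_(g in G) F g = \sum_(g in G) F (h * g)%g.
Proof.
move=> Gh; rewrite (reindex_inj (mulgI h)) /=.
by apply: eq_bigl => g; rewrite groupMl.
Qed.

Section FrameOperator.
Variables (C : numClosedFieldType) (gT : finGroupType) (G : {group gT}).
Variables (V : vectType C) (form : {dot V for Num.conj}).
Variable rho : gT -> 'End(V).
Hypothesis rho_repr : is_unitary_repr G form rho.
Implicit Types (u v x : V) (U W : {vspace V}).
Local Notation "'[ u , w ]" := (inner form u w).
Local Notation invariant := (invariant_subspace G rho).
Local Notation cyclic_span := (cyclic_subspace G rho).

Lemma unitary_repr1 x : rho 1%g x = x.
Proof. by case: rho_repr => -> _ _; rewrite id_lfunE. Qed.

Lemma unitary_reprM g h x :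
  g \in G -> h \in G -> rho (g * h)%g x = rho g (rho h x).
Proof. by case: rho_repr => _ rhoM _ Gg Gh; rewrite rhoM ?comp_lfunE. Qed.

Lemma unitary_reprVK g x : g \in G -> rho g (rho g^-1%g x) = x.
Proof. by move=> Gg; rewrite -unitary_reprM ?groupV // mulgV unitary_repr1. Qed.

Lemma inner_repr g x y : g \in G -> '[rho g x, rho g y] = '[x, y].
Proof. by case: rho_repr => _ _ rhoU Gg; rewrite rhoU. Qed.

Lemma inner_reprl g x y : g \in G -> '[rho g x, y] = '[x, rho g^-1%g y].
Proof. by move=> Gg; rewrite -{1}(unitary_reprVK y Gg) inner_repr. Qed.

Lemma invariant_mem U g x : invariant U -> g \in G -> x \in U -> rho g x \in U.
Proof. by move=> invU Gg xU; rewrite (subvP (invU g Gg)) ?memv_img. Qed.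

Lemma invariantP U :
  (forall g x, g \in G -> x \in U -> rho g x \in U) -> invariant U.
Proof.
by move=> invU g Gg; apply/subvP => _ /memv_imgP[x xU ->]; apply: invU.
Qed.

Lemma orthov_invariant U : invariant U -> invariant (orthov form U).
Proof.
move=> invU; apply: invariantP => g x Gg /mem_orthov_inner oxU.
apply/mem_orthov_inner => w wU; rewrite -[g]invgK -inner_reprl ?groupV //.
by apply: oxU; apply: invariant_mem; rewrite ?groupV.
Qed.

Lemma orbit_cyclic v g : g \in G -> rho g v \in cyclic_span v.
Proof. by move=> Gg; rewrite memv_span //; apply: image_f. Qed.

Lemma mem_cyclic v : v \in cyclic_span v.
Proof. by rewrite -{1}[v]unitary_repr1 orbit_cyclic. Qed.

Lemma cyclic_sub U v : invariant U -> v \in U -> (cyclic_span v <= U)%VS.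
Proof.
move=> invU vU; apply/span_subvP => _ /imageP[g Gg ->].
exact: invariant_mem.
Qed.

Lemma cyclic_invariant v : invariant (cyclic_span v).
Proof.
move=> h Gh; rewrite limg_span.
apply/span_subvP => _ /mapP[_ /imageP[g Gg ->] ->].
by rewrite -unitary_reprM // orbit_cyclic ?groupM.
Qed.

Definition frame v x : V :=
  #|G|%:R^-1 *: \sum_(g in G) '[rho g v, x] *: rho g v.

Fact frame_is_linear v : linear (frame v).
Proof.
move=> a x y; rewrite /frame scalerA mulrC -scalerA -scalerDr.
rewrite [X in _ = _ *: (X + _)]scaler_sumr -big_split.
congr (_ *: _); apply: eq_bigr => g _ /=.
by rewrite innerDr innerZr scalerDl scalerA.
Qed.

Definition frame_op v : 'End(V) :=
  linfun (HB.pack_for {linear V -> V} (frame v)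
    (GRing.isLinear.Build C V V *:%R (frame v) (frame_is_linear v))).

Lemma frame_opE v x : frame_op v x = frame v x.
Proof. by rewrite lfunE. Qed.

Lemma frame_repr v h x : h \in G -> frame v (rho h x) = rho h (frame v x).
Proof.
move=> Gh; rewrite /frame linearZ (sum_group_mull _ Gh) /=.
congr (_ *: _); rewrite linear_sum; apply: eq_bigr => g Gg.
by rewrite linearZ unitary_reprM // inner_repr.
Qed.

Lemma inner_frame v u :
  '[u, frame v u] = #|G|%:R^-1 * \sum_(g in G) `|'[u, rho g v]| ^+ 2.
Proof.
rewrite innerZr inner_sumr; congr (_ * _); apply: eq_bigr => g _.
by rewrite innerZr normCK [in RHS]innerC conjCK [in RHS]mulrC -innerC.
Qed.

Lemma mean_sq_coef_frame v : mean_sq_coef G form rho v = '[v, frame v v].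
Proof. by rewrite inner_frame. Qed.

Lemma frame_selfadjoint v x y : '[frame v x, y] = '[x, frame v y].
Proof.
rewrite innerZl innerZr inner_suml inner_sumr rmorphV ?unitfE; last first.
  by rewrite pnatr_eq0 -lt0n cardG_gt0.
rewrite rmorph_nat; congr (_ * _); apply: eq_bigr => g _.
by rewrite innerZl innerZr -innerC mulrC.
Qed.

Lemma frame_cyclic v x : frame v x \in cyclic_span v.
Proof.
by rewrite memvZ // memv_suml // => g Gg; rewrite memvZ // orbit_cyclic.
Qed.

(** On E, the frame operator of v agrees with that of e: their difference maps
    E into E and, the orbit of e' being orthogonal to E, into the orthogonal
    complement.  The operator x |-> <w, x> w has trace <w, w>, so the frame
    operator of e has trace <e, e> on E. *)
Lemma frame_trace v (E : {vspace V}) e e' a :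
    invariant E -> e \in E -> e' \in orthov form E -> v = e + e' ->
    {in E, forall x, frame v x = a *: x} ->
  a * (\dim E)%:R = '[e, e].
Proof.
move=> invE eE e'E v_def Ea.
have frameE x : x \in E ->
    frame v x = #|G|%:R^-1 *: \sum_(g in G) '[rho g e, x] *: rho g e.
  move=> xE; set y := (RHS).
  have yE : y \in E.
    by rewrite memvZ // memv_suml // => g Gg; rewrite memvZ // invariant_mem.
  have : frame v x - y \in (E :&: orthov form E)%VS.
    rewrite memv_cap memvB //=; last by rewrite Ea ?memvZ.
    rewrite /y /frame -scalerBr -sumrB memvZ //.
    rewrite memv_suml // => g Gg.
    have oe' := invariant_mem (orthov_invariant invE) Gg e'E.
    have rho_v : rho g v = rho g e + rho g e' by rewrite v_def linearD.
    have -> : '[rho g v, x] = '[rho g e, x].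
      rewrite rho_v innerDl [X in _ + X]innerC.
      by rewrite (mem_orthov_inner _ _ _ oe') ?conjC0 ?addr0.
    by rewrite -scalerBr rho_v addrC addKr memvZ.
  by rewrite orthov_capv memv0 subr_eq0 => /eqP.
pose b := vbasis E.
have memb (i : 'I_(\dim E)) : b`_i \in E.
  by rewrite vbasis_mem ?mem_nth ?size_tuple.
transitivity (\sum_(i < \dim E) coord b i (frame v b`_i)).
  rewrite (eq_bigr (fun=> a)) => [|i _].
    by rewrite sumr_const card_ord mulr_natr.
  rewrite Ea // linearZ /= coord_free ?(basis_free (vbasisP E)) //.
  by rewrite eqxx mulr1.
under eq_bigr => i _ do rewrite frameE // linearZ linear_sum.
rewrite -mulr_sumr exchange_big /=.
under eq_bigr => g Gg.
  under eq_bigr => i _ do rewrite linearZ /= mulrC -innerZr.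
  rewrite -inner_sumr -coord_vbasis ?invariant_mem // inner_repr //.
  over.
by rewrite sumr_const -[X in _ * X]mulr_natl mulKf // pnatr_eq0 -lt0n cardG_gt0.
Qed.

(** The summand e is nonzero: otherwise the orbit of v, and with it the whole
    cyclic subspace, would be orthogonal to its nonzero subspace E. *)
Lemma eigenspace_splitting v : v != 0 ->
  exists E e e',
   [/\ invariant E, (E <= cyclic_span v)%VS, e \in E, e != 0
     & e' \in orthov form E]
   /\ [/\ v = e + e' & mean_sq_coef G form rho v =
        '[e, e] ^+ 2 / (\dim E)%:R + mean_sq_coef G form rho e'].
Proof.
move=> v_neq0.
have W_neq0 : cyclic_span v != 0%VS.
  by apply: contraNneq v_neq0 => W0; rewrite -memv0 -W0 mem_cyclic.
have stabW : (frame_op v @: cyclic_span v <= cyclic_span v)%VS.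
  by apply/subvP => _ /memv_imgP[x _ ->]; rewrite frame_opE frame_cyclic.
have [a [x [xW x_neq0 xa]]] := eigenvector_stable W_neq0 stabW.
pose E := (cyclic_span v :&: lker (frame_op v - a *: \1%VF))%VS.
have memE y : (y \in E) = (y \in cyclic_span v) && (frame v y == a *: y).
  rewrite memv_cap memv_ker add_lfunE opp_lfunE scale_lfunE id_lfunE.
  by rewrite frame_opE subr_eq0.
have Ea y : y \in E -> frame v y = a *: y by rewrite memE => /andP[_ /eqP].
have xE : x \in E by rewrite memE xW -frame_opE xa eqxx.
have invE : invariant E.
  apply: invariantP => g y Gg; rewrite !memE => /andP[yW /eqP ya].
  rewrite frame_repr // ya linearZ eqxx andbT invariant_mem //.
  exact: cyclic_invariant.
have [e [e' [v_def eE e'E]]] := orthogonal_decomposition form E v.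
have tr_a := frame_trace invE eE e'E v_def Ea.
exists E, e, e'; split; split => //; first exact: capvSl.
  apply: contraNneq x_neq0 => e0.
  rewrite -memv0 -(orthov_capv form E) memv_cap xE.
  apply: subvP xW; apply: cyclic_sub; first exact: orthov_invariant.
  by rewrite v_def e0 add0r.
have dimE : (\dim E)%:R != 0 :> C.
  rewrite pnatr_eq0 dimv_eq0.
  by apply: contraNneq x_neq0 => E0; rewrite -memv0 -E0.
have oe' w : w \in E -> '[w, e'] = 0 by move/mem_orthov_inner: e'E; apply.
have oe'l w : w \in E -> '[e', w] = 0.
  by move=> wE; rewrite innerC oe' ?conjC0.
have Sv : frame v v = a *: e + frame v e'.
  by rewrite -(Ea e) // -!frame_opE -linearD -v_def.
have oSe' w : w \in E -> '[w, frame v e'] = 0.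
  by move=> wE; rewrite -frame_selfadjoint Ea // innerZl oe' // mulr0.
rewrite mean_sq_coef_frame Sv {1}v_def innerDl !innerDr oSe' // addr0.
rewrite innerZr [X in _ + (X + _)]innerZr oe'l // mulr0 add0r inner_frame.
have -> : a * '[e, e] = '[e, e] ^+ 2 / (\dim E)%:R.
  by rewrite expr2 -{3}tr_a mulrA mulfK // mulrC.
congr (_ + _ * _); apply: eq_bigr => g Gg; rewrite {1}v_def linearD innerDr.
by rewrite oe'l ?add0r // invariant_mem.
Qed.

(** * Bounding the mean square matrix coefficient *)

Lemma mean_sq_coef0 : mean_sq_coef G form rho 0 = 0.
Proof. by rewrite mean_sq_coef_frame innerC inner0r conjC0. Qed.

(** An eigenspace of the frame operator inside an irreducible cyclic subspace
    is the whole subspace, so the splitting has no second summand. *)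
Lemma mean_sq_coef_irreducible v :
    irreducible_subrepr G rho (cyclic_span v) ->
  mean_sq_coef G form rho v = '[v, v] ^+ 2 / (\dim (cyclic_span v))%:R.
Proof.
move=> [_ W_neq0 irrW].
have v_neq0 : v != 0.
  apply: contraNneq W_neq0 => v0; rewrite -subv0 cyclic_sub ?v0 ?mem0v //.
  by apply: invariantP => g _ _ /[!memv0] /eqP->; rewrite linear0.
have [E [e [e' [[invE EW eE e_neq0 e'E] [v_def ->]]]]] :=
  eigenspace_splitting v_neq0.
have [E0 | EW_eq] := irrW E invE EW; first by rewrite -memv0 -E0 eE in e_neq0.
have e'0 : e' = 0.
  apply/eqP; rewrite -memv0 -(orthov_capv form E) memv_cap e'E andbT.
  by rewrite -(addKr e e') -v_def addrC memvB // EW_eq mem_cyclic.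
by rewrite -EW_eq v_def e'0 mean_sq_coef0 !addr0.
Qed.

(** Induction on the dimension of the cyclic subspace: splitting off an
    eigenspace replaces v by e', whose cyclic subspace is contained in that of
    v and orthogonal to the nonzero subspace E, hence strictly smaller. *)
Lemma mean_sq_coef_bound (Q : {vspace V}) n v :
    (0 < n)%N ->
    (forall U, invariant U -> (U <= Q)%VS -> U != 0%VS -> (n <= \dim U)%N) ->
    (cyclic_span v <= Q)%VS ->
  mean_sq_coef G form rho v <= '[v, v] ^+ 2 / n%:R
  /\ (v != 0 -> mean_sq_coef G form rho v = '[v, v] ^+ 2 / n%:R ->
      \dim (cyclic_span v) = n).
Proof.
move=> n_gt0 dimQ; have [m] := ubnP (\dim (cyclic_span v)).
elim: m v => // m IHm v dim_v vQ.
have [-> | v_neq0] := eqVneq v 0.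
  by rewrite mean_sq_coef0 innerC inner0r conjC0 expr0n mul0r lexx.
have [E [e [e' [[invE EW eE e_neq0 e'E] [v_def Fv]]]]] :=
  eigenspace_splitting v_neq0.
have E_neq0 : E != 0%VS by apply: contraNneq e_neq0 => E0; rewrite -memv0 -E0.
have nE : (n <= \dim E)%N by apply: dimQ => //; apply: subv_trans EW vQ.
have e'W : e' \in cyclic_span v.
  by rewrite -(addKr e e') -v_def addrC memvB ?mem_cyclic ?(subvP EW).
have W'W : (cyclic_span e' <= cyclic_span v)%VS.
  by apply: cyclic_sub => //; apply: cyclic_invariant.
have W'E : (cyclic_span e' <= orthov form E)%VS.
  by apply: cyclic_sub => //; apply: orthov_invariant.
have dim_e' : (\dim (cyclic_span e') < m)%N.
  have W'IE : (cyclic_span e' :&: E)%VS = 0%VS.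
    apply/eqP; rewrite -subv0 -(orthov_capv form E) capvC.
    by rewrite subv_cap capvSl (subv_trans (capvSr _ _) W'E).
  have sumW : (cyclic_span e' + E <= cyclic_span v)%VS by rewrite subv_add W'W.
  rewrite -ltnS (leq_trans _ dim_v) // ltnS (leq_trans _ (dimvS sumW)) //.
  by rewrite dimv_disjoint_sum // -addn1 leq_add2l lt0n dimv_eq0.
have [Fe' _] := IHm e' dim_e' (subv_trans W'W vQ).
have e_gt0 : 0 < '[e, e] by rewrite lt_def inner_eq0 e_neq0 inner_ge0.
have e'_ge0 := inner_ge0 form e'.
have n_gt0C : 0 < n%:R :> C by rewrite ltr0n.
have oee' : '[e, e'] = 0 by move/mem_orthov_inner: e'E; apply.
have oe'e : '[e', e] = 0 by rewrite innerC oee' conjC0.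
have v_norm : '[v, v] = '[e, e] + '[e', e'].
  by rewrite v_def innerDl !innerDr oee' oe'e addr0 add0r.
have Fe : '[e, e] ^+ 2 / (\dim E)%:R <= '[e, e] ^+ 2 / n%:R.
  rewrite ler_pM2l ?exprn_gt0 // lef_pV2 ?ler_nat // posrE ltr0n //.
  exact: leq_trans n_gt0 nE.
have Fsum : '[e, e] ^+ 2 / n%:R + '[e', e'] ^+ 2 / n%:R
              + ('[e, e] * '[e', e'] / n%:R) *+ 2 = '[v, v] ^+ 2 / n%:R.
  by rewrite v_norm sqrrD -mulrnAl -!mulrDl addrAC.
have cross_ge0 : 0 <= '[e, e] * '[e', e'] / n%:R.
  by apply: mulr_ge0; [rewrite mulr_ge0 // ltW | rewrite invr_ge0 ltW].
rewrite Fv -Fsum; split.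
  by apply: ler_wpDr; rewrite ?mulrn_wge0 // lerD.
move=> _ Feq.
have /eqP e'0 : e' == 0.
  have : ('[e, e] * '[e', e'] / n%:R) *+ 2 == 0.
    rewrite eq_le mulrn_wge0 // andbT.
    by rewrite -(gerDl ('[e, e] ^+ 2 / n%:R + '[e', e'] ^+ 2 / n%:R)) -Feq lerD.
  rewrite mulrn_eq0 !mulf_eq0 invr_eq0 !inner_eq0 (negPf e_neq0).
  by rewrite (gt_eqF n_gt0C) orbF.
have v_e : v = e by rewrite v_def e'0 addr0.
have WE : cyclic_span v = E.
  by apply/eqP; rewrite eqEsubv EW andbT cyclic_sub // v_e.
rewrite WE; apply/eqP; rewrite -(eqr_nat C) -(inj_eq invr_inj).
rewrite -(inj_eq (mulfI (lt0r_neq0 (exprn_gt0 2 e_gt0)))).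
apply/eqP; move: Feq; rewrite e'0 mean_sq_coef0 inner0r expr0n /= mulr0.
by rewrite !mul0r mul0rn !addr0.
Qed.
End FrameOperator.

(** * Conjugation of characters *)

Section CharacterConjugation.
Variables (C : numClosedFieldType) (gT : finGroupType) (G : {group gT}).
Variables (n : nat) (rG : mx_representation C G n).
Local Notation "M ^*t" := (map_mx Num.conj M^T) (at level 2).

(** The matrix, in the standard basis, of the standard Hermitian form summed
    over G. *)
Let gram : 'M[C]_n := \sum_(g in G) rG g *m (rG g)^*t.

Let conjtM p q r (A : 'M[C]_(p, q)) (B : 'M_(q, r)) :
  (A *m B)^*t = B^*t *m A^*t.
Proof. by rewrite trmx_mul map_mxM. Qed.

Let gram_repr h : h \in G -> rG h *m gram *m (rG h)^*t = gram.
Proof.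
move=> Gh; rewrite /gram mulmx_sumr mulmx_suml.
rewrite [RHS](sum_group_mull _ Gh); apply: eq_bigr => g Gg.
by rewrite repr_mxM // conjtM !mulmxA.
Qed.

Let gram_unit : gram \in unitmx.
Proof.
rewrite -row_free_unit; apply: inj_row_free => x x_gram.
pose y g := x *m rG g.
have y_ge0 g : 0 <= (y g *m (y g)^*t) 0 0.
  by rewrite !mxE sumr_ge0 // => j _; rewrite !mxE -normCK exprn_ge0.
have sum0 : \sum_(g in G) (y g *m (y g)^*t) 0 0 = 0.
  rewrite -summxE -[RHS](_ : (x *m gram *m x^*t) 0 0 = 0); last first.
    by rewrite x_gram mul0mx mxE.
  rewrite /gram mulmx_sumr mulmx_suml; congr (fun_of_matrix _ 0 0).
  by apply: eq_bigr => g _; rewrite /y conjtM !mulmxA.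
have /eqP := psumr_eq0P (fun g _ => y_ge0 g) sum0 (group1 G).
rewrite /y repr_mx1 mulmx1 mxE psumr_eq0 => [|j _]; last first.
  by rewrite !mxE -normCK exprn_ge0.
move=> /allP x0; apply/rowP => j; have := x0 j (mem_index_enum j).
by rewrite !mxE -normCK expf_eq0 normr_eq0 => /eqP.
Qed.

(** Invariance of the summed form makes the conjugate transpose of [rG g]
    similar, through [gram], to [rG g^-1]. *)
Lemma repr_traceV g : g \in G -> \tr (rG g^-1%g) = (\tr (rG g))^*.
Proof.
move=> Gg; transitivity (\tr (rG g)^*t); last first.
  by rewrite trace_map_mx mxtrace_tr.
have -> : (rG g)^*t = invmx gram *m (rG g^-1%g *m gram).
  rewrite -[in rG _ *m _](gram_repr Gg) !mulmxA -(mulmxA (invmx _)).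
  rewrite -repr_mxM ?groupV // mulVg repr_mx1 mulmx1.
  by rewrite mulVmx ?mul1mx // gram_unit.
by rewrite mxtrace_mulC -mulmxA mulmxV ?gram_unit // mulmx1.
Qed.
End CharacterConjugation.

(** * Invariant subspaces of the isotypic component *)

Section IsotypicComponent.
Variables (C : numClosedFieldType) (gT : finGroupType) (G : {group gT}).
Variables (V : vectType C) (form : {dot V for Num.conj}).
Variable rho : gT -> 'End(V).
Hypothesis rho_repr : is_unitary_repr G form rho.
Variables (n : nat) (rG : mx_representation C G n) (chi : gT -> C).
Hypothesis rG_irr : mx_irreducible rG.
Hypothesis chi_rG : {in G, forall g, chi g = \tr (rG g)}.
Implicit Types (u v w x : V) (U W : {vspace V}).
Local Notation "'[ u , w ]" := (inner form u w).
Local Notation invariant := (invariant_subspace G rho).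
Local Notation P := (isotypic_proj G rho chi).

Lemma char1_dim : chi 1%g = n%:R.
Proof. by rewrite chi_rG // repr_mx1 mxtrace1. Qed.

Lemma dim_irr_gt0 : (0 < n)%N.
Proof. by case/mx_irrP: rG_irr. Qed.

Lemma charV g : g \in G -> chi g^-1%g = (chi g)^*.
Proof. by move=> Gg; rewrite !chi_rG ?groupV // repr_traceV. Qed.

Lemma char_conj g h : g \in G -> h \in G -> chi (g ^ h)%g = chi g.
Proof.
move=> Gg Gh; rewrite !chi_rG ?groupJ // /conjg !repr_mxM ?groupM ?groupV //.
by rewrite mxtrace_mulC -mulmxA -repr_mxM ?groupV // mulgV repr_mx1 mulmx1.
Qed.

Lemma isotypic_projE x :
  P x = (n%:R / #|G|%:R) *: \sum_(g in G) (chi g)^* *: rho g x.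
Proof.
rewrite /isotypic_proj scale_lfunE sum_lfunE char1_dim; congr (_ *: _).
by apply: eq_bigr => g _; rewrite scale_lfunE.
Qed.

Lemma isotypic_proj_selfadjoint x y : '[P x, y] = '[x, P y].
Proof.
rewrite !isotypic_projE innerZl innerZr inner_suml inner_sumr.
rewrite rmorphM fmorphV !rmorph_nat; congr (_ * _).
rewrite (reindex_inj invg_inj) /=; apply: eq_big => [g | g]; rewrite groupV //.
move=> Gg; rewrite innerZl innerZr charV // !conjCK.
by rewrite (inner_reprl rho_repr) ?groupV // invgK.
Qed.

Lemma isotypic_component_invariant : invariant (isotypic_component G rho chi).
Proof.
apply: invariantP => h _ Gh /memv_imgP[x _ ->].
suff -> : rho h (P x) = P (rho h x) by rewrite memv_img ?memvf.
rewrite !isotypic_projE linearZ; congr (_ *: _); rewrite linear_sum.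
rewrite [RHS](reindex_inj (conjg_inj h^-1%g)) /=.
apply: eq_big => [g | g Gg]; first by rewrite groupJr ?groupV.
rewrite linearZ char_conj ?groupV //=.
rewrite -!(unitary_reprM rho_repr) ?groupJ ?groupV //.
by rewrite conjgE invgK !mulgA mulgKV.
Qed.

Section InvariantSubspace.
Variable U : {vspace V}.
Hypotheses (invU : invariant U) (U_neq0 : U != 0%VS).
Hypothesis U_chi : (U <= isotypic_component G rho chi)%VS.

(** The vectors f_i = sum_g conj(rG(g)_ij) rho(g) u, for u in U and j fixed,
    transform under rho by the matrices conj(rG(k^-1)).  Those with i = j add
    up, over j, to a nonzero multiple of P u.  Since P is self-adjoint and u
    lies in its image, P u = 0 would force u = 0; so for u nonzero, j can be
    chosen with f_j nonzero. *)
Lemma isotypic_hom : exists f : n.-tuple V,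
  [/\ forall i : 'I_n, f`_i \in U, exists i : 'I_n, f`_i != 0
    & forall k (i : 'I_n), k \in G ->
        rho k f`_i = \sum_(l < n) (rG k^-1%g i l)^* *: f`_l].
Proof.
have [u uU u_neq0] : exists2 u, u \in U & u != 0.
  by exists (vpick U); rewrite ?memv_pick ?vpick0.
pose f i j : V := \sum_(g in G) (rG g i j)^* *: rho g u.
have Pu : P u != 0.
  have /memv_imgP[w _ u_def] := subvP U_chi u uU.
  apply: contraNneq u_neq0 => Pu0; rewrite -(inner_eq0 form).
  by rewrite {1}u_def isotypic_proj_selfadjoint Pu0 inner0r.
have trf : \sum_(g in G) (chi g)^* *: rho g u = \sum_(i < n) f i i.
  rewrite exchange_big; apply: eq_bigr => g Gg /=.
  by rewrite chi_rG // /mxtrace rmorph_sum scaler_suml.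
have [j fj_neq0] : exists j, f j j != 0.
  apply/existsP; apply: contraNT Pu; rewrite negb_exists => /forallP f0.
  rewrite isotypic_projE trf big1 ?scaler0 // => i _.
  by apply/eqP; rewrite -[_ == _]negbK f0.
have f_nth (i : 'I_n) : [tuple f i j | i < n]`_i = f i j.
  by rewrite -tnth_nth tnth_mktuple.
exists [tuple f i j | i < n]; split=> [i | | k i Gk].
- rewrite f_nth memv_suml // => g Gg; rewrite memvZ //.
  exact: invariant_mem invU Gg uU.
- by exists j; rewrite f_nth.
rewrite f_nth /f linear_sum /=.
under eq_bigr => g Gg do
  rewrite linearZ /= -(unitary_reprM rho_repr) // -{1}(mulKg k g).
rewrite -(sum_group_mull (fun g => (rG (k^-1 * g)%g i j)^* *: rho g u) Gk) /=.
under [RHS]eq_bigr => l _ do rewrite f_nth scaler_sumr.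
rewrite exchange_big; apply: eq_bigr => g Gg /=.
rewrite repr_mxM ?groupV // mxE rmorph_sum scaler_suml.
by apply: eq_bigr => l _; rewrite rmorphM scalerA.
Qed.

(** The conjugates of the linear relations between the f_i form the row kernel
    of a matrix N with rG(k) N = N B_k for all k in G, that is, a submodule of
    the irreducible rG.  It is not everything since some f_i is nonzero, so it
    is zero and the f_i are free; the trace of rho k on their span is then
    conj(chi(k^-1)) = chi(k). *)
Lemma isotypic_copy : exists f : n.-tuple V,
  [/\ free f, (<<f>> <= U)%VS
    & {in G, forall k, \sum_(i < n) coord f i (rho k f`_i) = chi k}].
Proof.
have [f [fU [j fj_neq0] rho_f]] := isotypic_hom.
pose b := vbasis {:V}.
pose N := \matrix_(i < n, m < \dim {:V}) (coord b m f`_i)^*.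
(* The conjugations turn a relation with coefficients conj(y_i) into y *m N = 0,
   so that the kernel is a module for rG itself and not for its conjugate. *)
have mulN (y : 'rV_n) : (y *m N == 0) = (\sum_(i < n) (y 0 i)^* *: f`_i == 0).
  have yNE m : (y *m N) 0 m = (coord b m (\sum_(i < n) (y 0 i)^* *: f`_i))^*.
    rewrite mxE linear_sum rmorph_sum; apply: eq_bigr => i _.
    by rewrite linearZ rmorphM /= conjCK mxE.
  apply/eqP/eqP => [yN0 | f0]; last first.
    by apply/rowP => m; rewrite yNE f0 linear0 conjC0 mxE.
  rewrite [LHS](coord_vbasis (memvf _)) big1 // => m _.
  by rewrite -[coord _ _ _]conjCK -yNE yN0 mxE conjC0 scale0r.
have NkE k : k \in G ->
    rG k *m N = N *m \matrix_(p, m) (coord b m (rho k^-1%g b`_p))^*.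
  move=> Gk; apply/matrixP => i m; rewrite !mxE.
  have fk := rho_f k^-1%g i (groupVr Gk).
  transitivity ((coord b m (rho k^-1%g f`_i))^*).
    rewrite fk linear_sum rmorph_sum; apply: eq_bigr => l _.
    by rewrite linearZ rmorphM /= conjCK invgK mxE.
  rewrite {1}(coord_vbasis (memvf f`_i)) !linear_sum rmorph_sum.
  by apply: eq_bigr => p _; rewrite !linearZ rmorphM !mxE.
have kerN : kermx N = 0.
  apply/eqP; apply: contraT => kerN_neq0; case/negP: fj_neq0.
  have /mx_irrP[_ irrG] := rG_irr.
  have modN : mxmodule rG (kermx N).
    apply/mxmoduleP => k Gk; apply/sub_kermxP.
    by rewrite -mulmxA NkE // mulmxA mulmx_ker mul0mx.
  have /row_fullP[B BN] := irrG _ modN kerN_neq0.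
  have N0 : N = 0 by rewrite -[N]mul1mx -BN -mulmxA mulmx_ker mulmx0.
  have : (delta_mx 0 j : 'rV_n) *m N == 0 by rewrite N0 mulmx0.
  rewrite mulN (bigD1 j) //= big1 => [|i /negPf ij].
    by rewrite mxE !eqxx conjC1 scale1r addr0.
  by rewrite mxE ij andbF conjC0 scale0r.
have f_free : free f.
  apply/freeP => a a0 i.
  have : \row_l (a l)^* *m N == 0.
    rewrite mulN -[X in _ == X]a0; apply/eqP.
    by apply: eq_bigr => l _; rewrite mxE conjCK.
  move/eqP/sub_kermxP; rewrite kerN submx0 => /eqP/rowP/(_ i).
  by rewrite !mxE => /eqP; rewrite conjC_eq0 => /eqP.
exists f; split=> //.
  by apply/span_subvP => _ /tnthP[i ->]; rewrite (tnth_nth 0).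
move=> k Gk; rewrite -[k in RHS]invgK charV ?groupV // chi_rG ?groupV //.
rewrite rmorph_sum; apply: eq_bigr => i _.
by rewrite rho_f // coord_sum_free.
Qed.

Lemma isotypic_dim_ge : (n <= \dim U)%N.
Proof.
have [f [f_free fU _]] := isotypic_copy.
by move: (dimvS fU); rewrite (eqnP f_free) size_tuple.
Qed.

Lemma isotypic_minimal_character :
  \dim U = n -> {in G, forall g, subrepr_character rho U g = chi g}.
Proof.
move=> dimU g Gg; have [f [f_free fU <-//]] := isotypic_copy.
apply: (trace_basis_indep (vbasisP U)); last exact: invU.
by rewrite basisEfree f_free fU size_tuple dimU /=.
Qed.

End InvariantSubspace.
End IsotypicComponent.

Theorem theorem1 (R : realType) (gT : finGroupType) (G : {group gT})
    (V : vectType R[i]) (form : {dot V for Num.conj})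
    (rho : gT -> 'End(V)) (chi : gT -> R[i]) (v : V)
    (rho_repr : is_unitary_repr G form rho)
    (chi_irr : irreducible_character G chi)
    (v_chi : v \in isotypic_component G rho chi)
    (v_unit : vnorm form v = 1) :
  mean_sq_coef G form rho v <= 1 / chi 1%g /\
  (mean_sq_coef G form rho v = 1 / chi 1%g <->
     irreducible_subrepr G rho (cyclic_subspace G rho v) /\
     {in G, forall g,
        subrepr_character rho (cyclic_subspace G rho v) g = chi g}).
Proof.
have [n [rG [rG_irr chi_rG]]] := chi_irr.
have vv : inner form v v = 1.
  by rewrite -[LHS]sqrtCK -/(vnorm form v) v_unit expr1n.
have v_neq0 : v != 0 by rewrite -(inner_eq0 form) vv oner_neq0.
have invW := @cyclic_invariant _ _ _ _ _ _ rho_repr v.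
have W_neq0 : cyclic_subspace G rho v != 0%VS.
  by apply: contraNneq v_neq0 => W0; rewrite -memv0 -W0 (mem_cyclic rho_repr).
have W_chi : (cyclic_subspace G rho v <= isotypic_component G rho chi)%VS.
  apply: cyclic_sub => //.
  exact: (isotypic_component_invariant rho_repr chi_rG).
have dim_ge U : invariant_subspace G rho U ->
    (U <= isotypic_component G rho chi)%VS -> U != 0%VS -> (n <= \dim U)%N.
  by move=> *; apply: (isotypic_dim_ge rho_repr rG_irr chi_rG).
have [] := mean_sq_coef_bound rho_repr (dim_irr_gt0 rG_irr) dim_ge W_chi.
rewrite vv expr1n (char1_dim chi_rG) => le_n /(_ v_neq0) eq_n.
split=> //; split=> [/eq_n dimW | [irrW charW]].
  split; last exact: (isotypic_minimal_character rho_repr rG_irr chi_rG).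
  split=> // U invU UW; have [-> | U_neq0] := eqVneq U 0%VS; [by left | right].
  by apply/eqP; rewrite eqEdim UW dimW dim_ge // (subv_trans UW).
rewrite (mean_sq_coef_irreducible rho_repr irrW) vv expr1n.
rewrite -(char1_dim chi_rG) -charW // /subrepr_character.
(* The trace of the identity on the cyclic subspace is its dimension. *)
congr (_ / _); rewrite (eq_bigr (fun=> 1)) => [|i _].
  by rewrite sumr_const card_ord.
rewrite (unitary_repr1 rho_repr) coord_free ?(basis_free (vbasisP _)) //.
by rewrite eqxx.
Qed.
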